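(* Let $L$ be a nilpotent Lie algebra (over a field) of class $c$ which is generated by $n$ elements. Then $$\dim M(L) \leq \sum_{j=1}^{c} l_n(j+1),$$ where $l_n(q) = \frac{1}{q} \sum_{s \mid q} \mu(s)\, n^{q/s}$, the sum running over the positive divisors $s$ of $q$ and $\mu$ denoting the Möbius function.
   Context: All Lie algebras are over a fixed field. For a Lie algebra $L$, the lower central series is $L^1 = L$, $L^{i+1} = [L, L^i]$; $L$ is nilpotent of class $c$ if $L^{c+1} = 0$ and $L^c \neq 0$. The Schur multiplier of $L$ is $M(L) = (F^2 \cap R)/[F,R]$, where $F$ is a free Lie algebra, $R$ is an ideal of $F$ with $L \cong F/R$, and $F^2=[F,F]$; up to isomorphism this does not depend on the choice of the free presentation. *)

(* Defs.v *)
From HB Require Import structures.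
From mathcomp Require Import all_boot all_order all_algebra.
From mathcomp Require Import boolp classical_sets.

Set Implicit Arguments.
Unset Strict Implicit.
Unset Printing Implicit Defensive.

Import GRing.Theory.
Local Open Scope classical_set_scope.
Local Open Scope ring_scope.

(* Lie algebras of arbitrary, possibly infinite, dimension. *)
HB.mixin Record isLieAlgebra (K : fieldType) L of GRing.Lmodule K L := {
  lieb : L -> L -> L;
  liebDZl : forall (a : K) (x y z : L),
    lieb (a *: x + y) z = a *: lieb x z + lieb y z;
  liebDZr : forall (a : K) (x y z : L),
    lieb x (a *: y + z) = a *: lieb x y + lieb x z;
  liebxx : forall x : L, lieb x x = 0;
  lieb_jacobi : forall x y z : L,
    lieb x (lieb y z) + lieb y (lieb z x) + lieb z (lieb x y) = 0
}.

#[short(type="lieAlgType")]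
HB.structure Definition LieAlgebra (K : fieldType) :=
  {L of isLieAlgebra K L & GRing.Lmodule K L}.

Definition is_subspace (K : fieldType) (V : lmodType K) (U : set V) : Prop :=
  U 0 /\ forall (a : K) (u v : V), U u -> U v -> U (a *: u + v).

Definition is_subalgebra (K : fieldType) (L : lieAlgType K) (U : set L) : Prop :=
  is_subspace U /\ forall x y : L, U x -> U y -> U (lieb x y).

(* By antisymmetry of the bracket, one-sided and two-sided ideals coincide. *)
Definition is_ideal (K : fieldType) (L : lieAlgType K) (I : set L) : Prop :=
  is_subspace I /\ forall x y : L, I y -> I (lieb x y).

(* [A, B] is the linear span of the brackets, not just the set of brackets. *)
Definition lie_comm (K : fieldType) (L : lieAlgType K) (A B : set L) : set L :=
  smallest (@is_subspace K L) [set z | exists2 x, A x & exists2 y, B y & z = lieb x y].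

(* [lcs L i] is L^i, numbered from L^1 = L; [lcs L 0] is a dummy value. *)
Fixpoint lcs (K : fieldType) (L : lieAlgType K) (i : nat) : set L :=
  match i with
  | j.+1 => match j with
            | _.+1 => lie_comm setT (@lcs K L j)
            | 0 => setT
            end
  | 0 => setT
  end.
Arguments lcs {K} L i _ : rename.

(* L^{c+1} = 0 and L^c <> 0; the second condition has no meaning when c = 0,
   so that the zero algebra is the one of class 0. *)
Definition nilpotent_of_class (K : fieldType) (L : lieAlgType K) (c : nat) : Prop :=
  lcs L c.+1 = [set 0] /\ ((0 < c)%N -> lcs L c <> [set 0]).

Definition generated_by (K : fieldType) (L : lieAlgType K) (n : nat) : Prop :=
  exists x : 'I_n -> L, smallest (@is_subalgebra K L) (range x) = setT.

Definition is_lie_hom (K : fieldType) (L M : lieAlgType K) (f : L -> M) : Prop :=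
  linear f /\ forall x y : L, f (lieb x y) = lieb (f x) (f y).

Definition is_free_on (K : fieldType) (F : lieAlgType K) (X : Type) (i : X -> F) : Prop :=
  forall (M : lieAlgType K) (f : X -> M),
    exists g : F -> M, [/\ is_lie_hom g, (forall x, g (i x) = f x) &
      forall h : F -> M, is_lie_hom h -> (forall x, h (i x) = f x) -> h =1 g].

Definition is_free (K : fieldType) (F : lieAlgType K) : Prop :=
  exists (X : Type) (i : X -> F), is_free_on i.

(* F/R is isomorphic to L, through a surjection F -> L with kernel R. *)
Definition is_quotient (K : fieldType) (F : lieAlgType K) (R : set F)
    (L : lieAlgType K) : Prop :=
  exists p : F -> L, [/\ is_lie_hom p, range p = setT & R = p @^-1` [set 0]].

Definition is_free_presentation (K : fieldType) (F : lieAlgType K) (R : set F)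
    (L : lieAlgType K) : Prop :=
  [/\ is_free F, is_ideal R & is_quotient R L].

(* dim U/W = d for subspaces W of U: there are d vectors of U whose classes
   modulo W form a basis of U/W. *)
Definition dim_quotient (K : fieldType) (V : lmodType K) (U W : set V) (d : nat) : Prop :=
  [/\ is_subspace U, is_subspace W, W `<=` U &
  exists b : 'I_d -> V,
    [/\ (forall i, U (b i)),
        (forall a : 'I_d -> K, W (\sum_i a i *: b i) -> forall i, a i = 0) &
        (forall u, U u -> exists a : 'I_d -> K, W (u - \sum_i a i *: b i))]].

(* The Schur multiplier computed from a free presentation L = F/R is
   (F^2 `&` R) / [F, R]; this says that its dimension is d. *)
Definition dim_schur_multiplier (K : fieldType) (F : lieAlgType K) (R : set F)
    (d : nat) : Prop :=
  dim_quotient (lcs F 2 `&` R) (lie_comm setT R) d.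

Definition moebius (s : nat) : int :=
  if all (fun p => logn p s == 1)%N (primes s) then (-1) ^+ size (primes s) else 0.

Definition witt (n q : nat) : rat :=
  q%:R^-1 * \sum_(s <- divisors q) (moebius s)%:~R * n%:R ^+ (q %/ s)%N.

(* Main.v *)
Require Import Defs.
From mathcomp Require Import all_boot all_order all_algebra.
From mathcomp Require Import zify.
From mathcomp Require Import boolp classical_sets.

(** The bound holds because the multiplier is a subquotient of a nilpotent Lie
algebra on [n] generators, and the Lyndon brackets span such an algebra.

Let [p : F -> L] be the presentation, with kernel [R], and lift the [n]
generators of [L] to elements [x i] of [F].  The subalgebra [A] they generate
satisfies [F = A + R], hence [[F, F] = [A, A]] modulo [[F, R]].  Since [L] has
class [c], [R] contains [F^(c+1)], so [[F, R]] contains [F^(c+2)].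
Therefore [F^2] is spanned modulo [[F, R]] by any family that spans [[A, A]]
modulo brackets of weight at least [c + 2] ([lcs2_span]).  The multiplier is
the subspace [(F^2 `&` R) / [F, R]] of [F^2 / [F, R]], so its dimension is at
most the size of such a family ([dim_quotient_le]).  Only the central
extension matters here; a universal property of [F] plays no role.

Every Lyndon word [w] in the letters [i < n] gives an iterated bracket [lynb w]
of the [x i], of weight [size w], obtained from the standard factorization
[w = u v] in which [v] is the least proper suffix of [w].  These brackets span
[A] because the bracket of two of them is again a combination of them
([lieb_lynb]): either [u v] is a standard factorization, or [u = u1 u2] with
[u2 < v] and the Jacobi identity applies; the termination argument is an
induction on the total length, then on the larger of the two words.

It remains to count Lyndon words of length [q].  The [q] rotations of a Lyndon
word are distinct, have trivial rotation stabilizer, and contain no other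
Lyndon word, so [q] times the number of Lyndon words is at most the number of
aperiodic words ([card_lyndon_aperiodic]).  As [n ^ j] words of length [q] are
fixed by the rotation by a divisor [j] of [q], Moebius inversion shows that
there are [q * witt n q] aperiodic words ([card_aperiodic]). *)

Set Implicit Arguments.
Unset Strict Implicit.
Unset Printing Implicit Defensive.

Import Order.TTheory GRing.Theory Num.Theory.
Import DefaultSeqLexiOrder.

(** * Lyndon words *)

Section Words.
Context {disp : Order.disp_t} {T : orderType disp}.
Local Open Scope order_scope.
Implicit Types (a : T) (s t u v w : seq T).

Lemma neq_nil_size s : (s != [::]) = (0 < size s)%N.
Proof. by rewrite lt0n size_eq0. Qed.

Lemma ltxi_cat2l s u v : (s ++ u < s ++ v) = (u < v).
Proof. by elim: s => //= a s IH; rewrite eqhead_ltxiE. Qed.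

Lemma lexi_catr s t : s <= s ++ t.
Proof. by elim: s => [|a s IH] /=; rewrite ?lexi0s ?eqhead_lexiE. Qed.

(** If [s < t] is decided by a letter, it survives arbitrary extensions. *)
Lemma ltxi_cat2r s t u v : s < t -> ~~ prefix s t -> s ++ u < t ++ v.
Proof.
elim: s t => [|a s IH] [|b t] //=.
have [<-|ab] := eqVneq a b; first by rewrite !eqhead_ltxiE /=; exact: IH.
by rewrite !neqhead_ltxiE.
Qed.

Lemma ltxi_cat_size s t u v : (size t <= size s)%N -> s < t -> s ++ u < t ++ v.
Proof.
move=> le_ts lt_st; apply: ltxi_cat2r => //; apply/negP => /prefixP[r tE].
move: lt_st le_ts; rewrite tE; case: r {tE} => [|b r]; first by rewrite cats0 ltxx.
by rewrite size_cat addnS ltnNge leq_addr.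
Qed.

(** The lexicographically least nonempty suffix of a nonempty word. *)
Fixpoint minsuf s := if s is a :: t then
  if t is [::] then s else Order.min s (minsuf t) else [::].

Lemma minsuf_neq0 s : s != [::] -> minsuf s != [::].
Proof.
by elim: s => //= a [|b s] // IH _; rewrite minEle; case: ifP => // _; apply: IH.
Qed.

Lemma minsuf_suffix s : {u | s = u ++ minsuf s}.
Proof.
elim: s => [|a s [u IH]]; first by exists [::].
case: s IH => [|b s] IH /=; first by exists [::].
rewrite minEle; case: ifP => _; first by exists [::].
by exists (a :: u); rewrite /= -IH.
Qed.

Lemma minsuf_le u v : v != [::] -> minsuf (u ++ v) <= v.
Proof.
move=> vN0; elim: u => [|a u IH] /=.
  by case: v vN0 => [|a [|b v]] //= _; rewrite ge_min lexx.
have: u ++ v != [::] by rewrite !neq_nil_size size_cat in vN0 *; lia.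
by case: (u ++ v) IH => // b w IH _; rewrite ge_min IH orbT.
Qed.

(** A Lyndon word is a nonempty word that is strictly smaller than each of its
proper nonempty suffixes. *)
Definition lyndon w :=
  (w != [::]) && all (fun i => w < drop i w) (iota 1 (size w).-1).

Lemma lyndonP w :
  reflect (w != [::] /\ forall u v, w = u ++ v -> u != [::] -> v != [::] -> w < v)
    (lyndon w).
Proof.
apply: (iffP andP) => -[wN0 w_lt]; split => //.
  move=> u v wE uN0 vN0; have /allP/(_ (size u)) := w_lt.
  rewrite {3}wE drop_size_cat //; apply; rewrite mem_iota wE size_cat.
  by move: uN0 vN0; rewrite !neq_nil_size; lia.
apply/allP => i; rewrite mem_iota => i_bnd.
apply: (w_lt (take i w)); rewrite ?cat_take_drop //.
- by rewrite neq_nil_size size_take; case: ifP; lia.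
- by rewrite neq_nil_size size_drop; lia.
Qed.

Lemma lyndon_neq0 w : lyndon w -> w != [::]. Proof. by case/andP. Qed.

Lemma cat_eq_cat u v s t : u ++ v = s ++ t ->
  (exists r, s = u ++ r /\ v = r ++ t) \/
  (exists r, [/\ r != [::], u = s ++ r & t = r ++ v]).
Proof.
elim: u s => [|a u IH] [|b s] /=.
- by move=> ->; left; exists [::].
- by move=> ->; left; exists (b :: s).
- by move=> <-; right; exists (a :: u).
case=> <- /IH [[r [-> ->]]|[r [rN0 -> ->]]]; first by left; exists r.
by right; exists r.
Qed.

Lemma lyndon_cat u v : lyndon u -> lyndon v -> u < v -> lyndon (u ++ v).
Proof.
move=> /lyndonP [uN0 u_lt] /lyndonP [vN0 v_lt] lt_uv.
(* When u is a prefix of v, say v = u ++ t, this reduces to v < t. *)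
have uv_lt_v : u ++ v < v.
  have [/prefixP[t vE]|uNv] := boolP (prefix u v); last first.
    by rewrite -[X in _ < X]cats0 ltxi_cat2r.
  have tN0 : t != [::].
    by apply: contraTneq lt_uv => t0; rewrite vE t0 cats0 ltxx.
  by rewrite [X in _ < X]vE ltxi_cat2l; apply: v_lt uN0 tN0.
apply/lyndonP; split=> [|s t /cat_eq_cat [[r [sE vE]]|[r [rN0 uE tE]]] sN0 tN0].
- by case: u uN0 {u_lt lt_uv uv_lt_v}.
- have [r0|rN0] := eqVneq r [::]; first by rewrite vE r0 in uv_lt_v *.
  exact: lt_trans uv_lt_v (v_lt _ _ vE rN0 tN0).
- rewrite tE ltxi_cat_size //; last exact: u_lt uE sN0 rN0.
  by rewrite uE size_cat leq_addl.
Qed.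

(** The standard factorization [w = stdl w ++ stdr w] of a word of length at
least two: [stdr w] is the least proper nonempty suffix of [w].  For a Lyndon
word this is also its longest proper Lyndon suffix. *)
Definition stdr w := minsuf (behead w).
Definition stdl w := take (size w - size (stdr w)) w.

Lemma std_cat w : stdl w ++ stdr w = w.
Proof.
case: w => [|a w] //; rewrite /stdl /stdr /=.
have [u wE] := minsuf_suffix w.
have -> : (size w).+1 - size (minsuf w) = (size u).+1.
  by rewrite {1}wE size_cat -addSn addnK.
have uE : take (size u) w = u by rewrite wE take_size_cat.
by rewrite /= uE -wE.
Qed.

Lemma stdl_neq0 w : w != [::] -> stdl w != [::].
Proof.
case: w => // a w _; rewrite neq_nil_size /stdl /stdr /=.
have [u /(congr1 size)] := minsuf_suffix w; rewrite size_cat => wE.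
by have -> : (size w).+1 - size (minsuf w) = (size u).+1 by lia.
Qed.

Lemma stdr_neq0 w : (1 < size w)%N -> stdr w != [::].
Proof. by case: w => [|a [|b w]] // _; apply: minsuf_neq0. Qed.

Lemma stdr_le u v : u != [::] -> v != [::] -> stdr (u ++ v) <= v.
Proof. by case: u => // a u _ vN0; apply: minsuf_le. Qed.

Lemma lyndon_stdr w : (1 < size w)%N -> lyndon (stdr w).
Proof.
move=> w_gt1; apply/lyndonP; split=> [|u v rE uN0 vN0]; first exact: stdr_neq0.
have wE : w = (stdl w ++ u) ++ v by rewrite -catA -rE std_cat.
have le_rv : stdr w <= v.
  by rewrite wE stdr_le // neq_nil_size size_cat ltn_addl // -neq_nil_size.
rewrite lt_neqAle le_rv andbT; apply: contraTneq uN0 => rEv.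
by rewrite neq_nil_size; move/(congr1 size): rE; rewrite rEv size_cat; lia.
Qed.

Lemma lyndon_stdl w : (1 < size w)%N -> lyndon w -> lyndon (stdl w).
Proof.
move=> w_gt1 /lyndonP [wN0 w_lt]; apply/lyndonP.
split=> [|s t lE sN0 tN0]; first exact: stdl_neq0.
have wE : w = s ++ (t ++ stdr w) by rewrite catA -lE std_cat.
have trN0 : t ++ stdr w != [::] by case: (t) tN0.
have lt_w := w_lt _ _ wE sN0 trN0.
rewrite ltNge; apply/negP => le_tl.
have [/prefixP[r lE2]|tNl] := boolP (prefix t (stdl w)).
  (* Cancelling t in w < t ++ stdr w gives r ++ stdr w < stdr w, although
     r ++ stdr w is a proper suffix of w. *)
  have wE2 : w = t ++ (r ++ stdr w) by rewrite catA -lE2 std_cat.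
  have rN0 : r != [::].
    apply: contraTneq sN0 => r0; rewrite neq_nil_size.
    by move/(congr1 size): lE; rewrite lE2 r0 !size_cat /=; lia.
  have rrN0 : r ++ stdr w != [::] by case: (r) rN0.
  move: lt_w; rewrite {1}wE2 ltxi_cat2l ltNge => /negP[].
  by rewrite {1}wE2; apply: stdr_le.
have lt_tl : t < stdl w.
  rewrite lt_neqAle le_tl andbT; apply: contraNneq tNl => <-; exact: prefix_refl.
have := ltxi_cat2r (stdr w) (stdr w) lt_tl tNl.
by rewrite std_cat ltNge (ltW lt_w).
Qed.

Lemma stdl_lt_stdr w : (1 < size w)%N -> lyndon w -> stdl w < stdr w.
Proof.
move=> w_gt1 /lyndonP [wN0 w_lt]; apply: (@le_lt_trans _ _ w).
  by rewrite -{2}[w]std_cat lexi_catr.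
by apply: (w_lt (stdl w)); rewrite ?std_cat ?stdl_neq0 ?stdr_neq0.
Qed.

(** A criterion for [u ++ v] to be the standard factorization.  A suffix
[r ++ v] of [u ++ v] with [r] a proper suffix of [u] is above [stdr u], hence
above [v]. *)
Lemma stdr_cat u v : lyndon u -> lyndon v ->
  (size u <= 1)%N || (v <= stdr u) -> stdr (u ++ v) = v.
Proof.
move=> /lyndonP [uN0 _] /lyndonP [vN0 v_lt] u_std.
apply: le_anti; rewrite stdr_le //=.
case: u uN0 u_std => // a u _ u_std; rewrite /stdr /=.
have [s /cat_eq_cat] := minsuf_suffix (u ++ v).
case=> [[r [_ vE]]|[r [rN0 uE ->]]].
  have [r0|rN0] := eqVneq r [::]; first by rewrite {1}vE r0.
  apply/ltW/(v_lt _ _ vE rN0)/minsuf_neq0.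
  by rewrite !neq_nil_size size_cat in vN0 *; lia.
apply: le_trans (lexi_catr r v).
case/orP: u_std => [|/le_trans]; first by move: rN0; rewrite uE neq_nil_size /= size_cat; lia.
by apply; rewrite /stdr /= uE minsuf_le.
Qed.

Lemma stdl_cat u v : lyndon u -> lyndon v ->
  (size u <= 1)%N || (v <= stdr u) -> stdl (u ++ v) = u.
Proof.
by move=> lu lv uv; rewrite /stdl stdr_cat // size_cat addnK take_size_cat.
Qed.

Lemma lyndon_lt_rot w i : lyndon w -> (0 < i < size w)%N -> w < rot i w.
Proof.
move=> /lyndonP [_ w_lt] i_bnd; apply: (@lt_le_trans _ _ (drop i w)); last exact: lexi_catr.
apply: (w_lt (take i w)); rewrite ?cat_take_drop // neq_nil_size.
  by rewrite size_takel; lia.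
by rewrite size_drop; lia.
Qed.

End Words.

(** * Sums of the Moebius function over divisors *)

Section Moebius.
Local Open Scope ring_scope.

Lemma sum_divisors (R : nmodType) (F : nat -> R) m N : (0 < m < N)%N ->
  \sum_(s <- divisors m) F s = \sum_(s < N | (s %| m)%N) F s.
Proof.
move=> m_bnd; rewrite -(big_mkord (fun s => s %| m)%N) -big_filter.
apply: perm_big; apply: uniq_perm; rewrite ?divisors_uniq ?filter_uniq ?iota_uniq //.
move=> s; rewrite mem_filter mem_index_iota -dvdn_divisors; last by lia.
by case: (boolP (s %| m)%N) => // /dvdn_leq; lia.
Qed.

Lemma moebius_mul_prime p t : prime p -> (0 < t)%N -> ~~ (p %| t)%N ->
  moebius (p * t) = - moebius t.
Proof.
move=> p_pr t_gt0 pNt; have p_gt0 := prime_gt0 p_pr.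
have pt : perm_eq (primes (p * t)) (p :: primes t).
  apply: uniq_perm; rewrite ?primes_uniq //= ?primes_uniq ?mem_primes ?(negPf pNt) ?andbF //.
  by move=> r; rewrite primesM // inE primes_prime // inE.
rewrite /moebius (perm_size pt) (perm_all _ pt) /= lognM // logn_prime // eqxx.
have -> : logn p t = 0%N by rewrite lognE p_pr t_gt0 (negPf pNt).
rewrite /= (@eq_in_all _ _ (fun r => logn r t == 1)%N) => [|r].
  by case: ifP => _; rewrite ?oppr0 // exprS mulN1r.
rewrite mem_primes lognM // logn_prime // => /and3P[_ _ r_t].
by have [rE|//] := eqVneq r p; rewrite rE (negPf pNt) in r_t.
Qed.

Lemma moebius_sq p s : prime p -> (0 < s)%N -> (p ^ 2 %| s)%N -> moebius s = 0.
Proof.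
move=> p_pr s_gt0; rewrite pfactor_dvdn // => p2_s; rewrite /moebius; case: ifP => // /allP/(_ p).
rewrite -logn_gt0 => /(_ (leq_trans _ p2_s)) /eqP; lia.
Qed.

Lemma sum_moebius m : (0 < m)%N ->
  \sum_(s <- divisors m) moebius s = (m == 1)%N%:R.
Proof.
move=> m_gt0; have [->|m_neq1] := eqVneq m 1%N; first by rewrite big_seq1.
have p_pr : prime (pdiv m) by apply: pdiv_prime; lia.
set p := pdiv m in p_pr; have p_m : (p %| m)%N by exact: pdiv_dvd.
have p_gt1 := prime_gt1 p_pr.
rewrite (@sum_divisors _ _ _ m.+1); last by lia.
pose P (s : 'I_m.+1) := (s %| m)%N && ~~ (p ^ 2 %| s)%N.
(* Multiplying or dividing by p is a sign-reversing involution on the divisors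
   of m that are not divisible by the square of p. *)
pose f (s : 'I_m.+1) : 'I_m.+1 := inord (if (p %| s)%N then s %/ p else p * s)%N.
have PfE s : P s -> [/\ P (f s), f (f s) = s & moebius (f s) = - moebius s].
  case/andP=> s_m p2Ns; have s_gt0 : (0 < s)%N by apply: dvdn_gt0 s_m.
  have [/dvdnP[t sE]|pNs] := boolP (p %| s)%N.
    have fsE : f s = t :> nat.
      rewrite /f sE dvdn_mull // mulnK ?inordK //; last by lia.
      by have := ltn_ord s; rewrite sE; nia.
    have pNt : ~~ (p %| t)%N by move: p2Ns; rewrite sE mulnC expnS expn1 dvdn_pmul2l //; lia.
    have t_gt0 : (0 < t)%N by move: s_gt0; rewrite sE; nia.
    split.
    - rewrite /P fsE (dvdn_trans _ s_m) ?sE ?dvdn_mulr //=.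
      by apply: contra pNt; apply: dvdn_trans; rewrite dvdn_exp.
    - apply: val_inj; rewrite /= {1}/f fsE (negPf pNt) inordK mulnC -sE //.
    - by rewrite fsE sE mulnC moebius_mul_prime // opprK.
  have ps_m : (p * s %| m)%N by rewrite Gauss_dvd ?p_m // prime_coprime.
  have fsE : f s = (p * s)%N :> nat.
    by rewrite /f (negPf pNs) inordK // ltnS dvdn_leq.
  split.
  - by rewrite /P fsE ps_m expnS expn1 dvdn_pmul2l //; lia.
  - apply: val_inj; rewrite /= {1}/f fsE dvdn_mulr // mulKn ?inordK //; lia.
  - by rewrite fsE moebius_mul_prime.
have -> : \sum_(s < m.+1 | (s %| m)%N) moebius s = \sum_(s < m.+1 | P s) moebius s.
  rewrite big_mkcond [RHS]big_mkcond; apply: eq_bigr => s _ /=; rewrite /P.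
  have [s_m|//] := boolP (s %| m)%N; have s_gt0 : (0 < s)%N by apply: dvdn_gt0 s_m.
  by have [p2_s|//] := boolP (p ^ 2 %| s)%N; rewrite (moebius_sq p_pr s_gt0 p2_s).
have : \sum_(s < m.+1 | P s) moebius s = - \sum_(s < m.+1 | P s) moebius s.
  rewrite {1}(reindex_onto f f) => [|s /PfE[]//].
  rewrite -sumrN; apply: eq_big => [s|s /andP[Ps /eqP ffs]].
    apply/andP/idP => [[Pfs /eqP <-]|/PfE[-> -> //]].
    by have [] := PfE _ Pfs.
  by rewrite -{2}ffs; have [_ _ ->] := PfE _ Ps; rewrite opprK.
lia.
Qed.
End Moebius.

(** * Counting aperiodic words and Lyndon words *)

Section Count.
Local Open Scope nat_scope.

(** The exponents of the iterates of [f] that fix [x] are the multiples of the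
least positive one. *)
Lemma iter_period (X : eqType) (f : X -> X) x q : 0 < q -> iter q f x = x ->
  exists2 d, 0 < d & forall j, (iter j f x == x) = (d %| j).
Proof.
move=> q_gt0 fq; pose P d := (0 < d) && (iter d f x == x).
have exP : exists d, P d by exists q; rewrite /P q_gt0 fq eqxx.
have [d /andP[d_gt0 /eqP fd] d_min] := ex_minnP exP.
have fdM k : iter (k * d) f x = x by elim: k => //= k IH; rewrite mulSn iterD IH.
exists d => // j; rewrite {1}(divn_eq j d) addnC iterD fdM /dvdn.
apply/eqP/eqP => [fj|-> //]; apply/eqP; rewrite -leqn0 leqNgt.
apply/negP => jd_gt0; have := d_min (j %% d); rewrite /P jd_gt0 fj eqxx => /(_ isT).
by rewrite leqNgt ltn_pmod.
Qed.

Lemma iter_rot1 (T : Type) (w : seq T) j : j <= size w -> iter j (rot 1) w = rot j w.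
Proof.
elim: j => [|j IH] j_le; first by rewrite rot0.
by rewrite iterS IH ?(ltnW j_le) // [RHS]rotS.
Qed.

(** A word is aperiodic when its nontrivial rotations all differ from it. *)
Definition aperiodic (T : eqType) (w : seq T) :=
  [forall i : 'I_(size w), (0 < i) ==> (rot i w != w)].

Lemma aperiodic_rot_lyndon d (T : orderType d) (w : seq T) i :
  lyndon w -> aperiodic (rot i w).
Proof.
move=> lw; apply/forallP => j; apply/implyP => j_gt0; rewrite rot_rot (inj_eq (@rot_inj _ _)).
have := @lyndon_lt_rot _ _ w j lw; rewrite j_gt0 -{1}(size_rot i w) ltn_ord => /(_ isT).
by rewrite lt_neqAle eq_sym => /andP[].
Qed.

Lemma lyndon_rot_inj d (T : orderType d) (w w' : seq T) i j : lyndon w -> lyndon w' ->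
  size w = size w' -> i < size w -> j < size w -> rot i w = rot j w' -> w = w' /\ i = j.
Proof.
move=> lw lw' sz i_lt j_lt.
wlog le_ij : i j w w' lw lw' sz i_lt j_lt / i <= j => [wl|].
  case: (leqP i j) => [|/ltnW] le; first exact: wl.
  by move/esym/wl; rewrite -?sz; case=> // -> ->.
rewrite -{1}(subnKC le_ij) rotD; last by rewrite subnKC // -sz ltnW.
move=> /rot_inj wE; have [ij|] := posnP (j - i).
  by rewrite ij rot0 in wE; split=> //; lia.
move=> k_gt0; have lt_w'w : (w' < w)%O.
  by rewrite wE; apply: lyndon_lt_rot => //; rewrite k_gt0 -sz; lia.
suff: (w < w')%O by rewrite ltNge (ltW lt_w'w).
have -> : w' = rot (size w - (j - i)) w.
  by rewrite [X in rot _ X]wE -rotD sz ?subnK ?rot_size //; lia.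
by apply: lyndon_lt_rot => //; lia.
Qed.

Lemma card_lyndon_aperiodic d (T : finOrderType d) q :
  q * #|[set w : q.-tuple T | lyndon w]| <= #|[set w : q.-tuple T | aperiodic w]|.
Proof.
pose f (wi : q.-tuple T * 'I_q) : q.-tuple T := [tuple of rot wi.2 wi.1].
set Lq := [set w | _]; rewrite -{1}[q]card_ord -cardsT mulnC -cardsX.
rewrite -(@card_in_imset _ _ f) => [|[w i] [w' j]]; last first.
  rewrite !inE /= !andbT => lw lw' /(congr1 val) /= wE.
  have [] := @lyndon_rot_inj _ T w w' i j lw lw'; rewrite ?size_tuple ?ltn_ord //.
  by move=> /val_inj-> /val_inj->.
apply/subset_leq_card/fintype.subsetP => v /imsetP[[w i]].
by rewrite !inE /= andbT => lw wE; rewrite wE; apply: aperiodic_rot_lyndon.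
Qed.

(** A word of length [q] fixed by the rotation by a divisor [j] of [q] is the
repetition of its prefix of length [j]. *)
Lemma card_rot_fixed (T : finType) q j : 0 < j -> j %| q -> 0 < q ->
  #|[set w : q.-tuple T | rot j w == w]| = #|T| ^ j.
Proof.
move=> j_gt0 j_q q_gt0; have j_le : j <= q by exact: dvdn_leq.
pose f (u : j.-tuple T) : q.-tuple T :=
  [tuple tnth u (Ordinal (ltn_pmod i j_gt0)) | i < q].
rewrite -(card_tuple j T) -(@card_imset _ _ f); last first.
  move=> u v uv; apply: eq_from_tnth => i.
  have := congr1 (fun w => tnth w (widen_ord j_le i)) uv; rewrite !tnth_mktuple.
  by have -> : Ordinal (ltn_pmod (widen_ord j_le i) j_gt0) = i
    by apply: val_inj; rewrite /= modn_small.
apply: eq_card => w; rewrite inE; apply/eqP/imsetP => [wE|[u _ ->]].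
  have x0 : T by exact: (tnth w (Ordinal q_gt0)).
  have wj i : i + j < q -> nth x0 w (i + j) = nth x0 w i.
    move=> ij; rewrite -{2}wE /rot nth_cat size_drop size_tuple nth_drop addnC.
    by have -> : i < q - j by lia.
  have wM k i : i + k * j < q -> nth x0 w (i + k * j) = nth x0 w i.
    elim: k => [|k IH]; rewrite ?addn0 // mulSn addnCA addnC => ik.
    by rewrite wj // IH //; lia.
  exists [tuple tnth w (widen_ord j_le i) | i < j] => //.
  apply: eq_from_tnth => i; rewrite !tnth_mktuple !(tnth_nth x0) /=.
  rewrite {1}(divn_eq i j) addnC wM //.
  by rewrite addnC -divn_eq ltn_ord.
have [->|/eqP/nilP] := eqVneq (f u : seq T) [::]; first by [].
move=> fuN0; have x0 : T by exact: (tnth (f u) (Ordinal q_gt0)).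
have fuE i : i < q -> nth x0 (f u) i = nth x0 u (i %% j).
  by move=> iq; rewrite -(tnth_nth x0 _ (Ordinal iq)) tnth_mktuple (tnth_nth x0).
apply: (@eq_from_nth _ x0) => [|i]; rewrite size_rot // size_tuple => iq.
rewrite [RHS]fuE // /rot nth_cat size_drop size_tuple ltn_subRL.
case: ltnP => ij; first by rewrite nth_drop fuE // modnDl.
rewrite nth_take; last by lia.
rewrite fuE; last by lia.
have /dvdnP[k qE] := j_q.
have qjE : q - j = k.-1 * j by rewrite qE; nia.
have {2}-> : i = (q - j) + (i - (q - j)) by lia.
by rewrite qjE modnMDl.
Qed.

End Count.

Section Witt.
Local Open Scope ring_scope.

(** Double counting of the pairs [(s, w)] where [s] divides [q] and [w] is fixed
by the rotation by [q %/ s], weighted by [moebius s].  If [d] is the least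
period of [w], these [s] are the divisors of [q %/ d], and their weights cancel
unless [d = q]. *)
Lemma card_aperiodic (T : finType) q : (0 < q)%N ->
  \sum_(s <- divisors q) (moebius s)%:~R * #|T|%:R ^+ (q %/ s) =
    #|[set w : q.-tuple T | aperiodic w]|%:R :> rat.
Proof.
move=> q_gt0.
have -> : \sum_(s <- divisors q) (moebius s)%:~R * #|T|%:R ^+ (q %/ s) =
    \sum_(w : q.-tuple T)
      \sum_(s <- divisors q | rot (q %/ s) w == w) (moebius s)%:~R :> rat.
  rewrite (exchange_big_dep predT) //=; apply: eq_big_seq => s.
  rewrite -dvdn_divisors // => /dvdnP[k qE].
  have [s_gt0 k_gt0] : (0 < s /\ 0 < k)%N by nia.
  rewrite qE mulnK // -natrX -(@card_rot_fixed _ q k) ?qE ?dvdn_mulr //; last by nia.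
  by rewrite sumr_const mulr_natr cardsE.
rewrite -sum1_card natr_sum [RHS]big_mkcond /=; apply: eq_bigr => w _; rewrite inE.
have wq : iter q (rot 1) w = w.
  by rewrite iter_rot1 ?size_tuple // -[X in rot X](size_tuple w) rot_size.
have [d d_gt0 wd] := iter_period q_gt0 wq.
have rotE j : (j <= q)%N -> (rot j w == w) = (d %| j)%N.
  by move=> jq; rewrite -wd iter_rot1 // size_tuple.
have d_q : (d %| q)%N by rewrite -wd wq eqxx.
have q'_gt0 : (0 < q %/ d)%N by rewrite divn_gt0 // dvdn_leq.
transitivity ((\sum_(s <- divisors (q %/ d)) moebius s)%:~R : rat).
  rewrite rmorph_sum -big_filter /=; apply: perm_big.
  apply: uniq_perm; rewrite ?filter_uniq ?divisors_uniq // => s.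
  rewrite mem_filter -!dvdn_divisors // rotE ?leq_div //.
  apply/andP/idP => [[d_qs s_q]|s_qd].
    by rewrite dvdn_divRL // mulnC -dvdn_divRL.
  have s_q : (s %| q)%N by apply: dvdn_trans s_qd (dvdn_div d_q).
  by rewrite s_q dvdn_divRL // mulnC -dvdn_divRL.
rewrite sum_moebius // natz -pmulrn.
have -> : (q %/ d == 1)%N = (d == q).
  by apply/eqP/eqP => [qd|->]; [rewrite -(divnK d_q) qd mul1n|rewrite divnn q_gt0].
have -> : aperiodic w = (d == q); last by case: eqP.
apply/forallP/eqP => [aper_w|dE i].
  apply/eqP; apply: contraT => dNq; have d_lt : (d < size w)%N.
    by rewrite size_tuple ltn_neqAle dNq dvdn_leq.
  have /= := aper_w (Ordinal d_lt); rewrite d_gt0 rotE ?dvdnn //.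
  by rewrite -[X in (_ <= X)%N](size_tuple w) ltnW.
have i_lt : (i < q)%N by rewrite -[X in (_ < X)%N](size_tuple w) ltn_ord.
by apply/implyP => i_gt0; rewrite rotE 1?ltnW // dE gtnNdvd.
Qed.

Lemma card_lyndon_le_witt n q : (0 < q)%N ->
  #|[set w : q.-tuple 'I_n | lyndon w]|%:R <= witt n q.
Proof.
move=> q_gt0; rewrite /witt mulrC ler_pdivlMr ?ltr0n //.
have := @card_aperiodic 'I_n q q_gt0; rewrite card_ord => ->.
rewrite mulrC -natrM ler_nat.
exact: card_lyndon_aperiodic.
Qed.
End Witt.

Local Open Scope classical_set_scope.
Local Open Scope ring_scope.

(** * Spans and dimensions of quotients *)

Section Subspaces.
Variables (K : fieldType) (V : lmodType K).
Implicit Types (U W S : set V).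

(** The linear span of [S]. *)
Definition vspan S : set V := smallest (@is_subspace K V) S.

Section Closure.
Variables (U : set V) (Usub : is_subspace U).
Lemma subspace0 : U 0. Proof. exact: Usub.1. Qed.
Lemma subspaceD u v : U u -> U v -> U (u + v).
Proof. by move=> Uu Uv; rewrite -[u]scale1r; apply: Usub.2. Qed.
Lemma subspaceZ a u : U u -> U (a *: u).
Proof. by move=> Uu; rewrite -[_ *: _]addr0; apply: Usub.2 => //; apply: subspace0. Qed.
Lemma subspaceN u : U u -> U (- u).
Proof. by rewrite -scaleN1r; apply: subspaceZ. Qed.
Lemma subspaceB u v : U u -> U v -> U (u - v).
Proof. by move=> Uu /subspaceN; apply: subspaceD. Qed.
Lemma subspace_sum (I : finType) (v : I -> V) : (forall i, U (v i)) -> U (\sum_i v i).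
Proof. by move=> Uv; apply: big_ind => //; [exact: subspace0 | exact: subspaceD]. Qed.
End Closure.

Lemma vspan_subspace S : is_subspace (vspan S).
Proof.
split=> [A [A0 _]|a u v Su Sv A [Asub SA]]; first exact: A0.1.
by apply: Asub.2; [apply: Su | apply: Sv].
Qed.

Lemma vspan_gen S v : S v -> vspan S v.
Proof. by move=> Sv A [_]; apply. Qed.

Lemma vspan_sub S U : is_subspace U -> S `<=` U -> vspan S `<=` U.
Proof. by move=> Usub SU v; apply. Qed.

Lemma subspaceI U W : is_subspace U -> is_subspace W -> is_subspace (U `&` W).
Proof.
move=> Us Ws; split=> [|a u v [Uu Wu] [Uv Wv]]; first by split; exact: subspace0.
by split; [apply: Us.2 | apply: Ws.2].
Qed.

Lemma vspan_seq_coord (vs : seq V) W v : is_subspace W ->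
  vspan ([set` vs] `|` W) v ->
  exists a : 'I_(size vs) -> K, W (v - \sum_i a i *: vs`_i).
Proof.
move=> Ws; move: v; apply: vspan_sub => [|v [/= v_vs|Wv]].
- split=> [|a u v [b Wb] [e We]].
    exists (fun=> 0); rewrite big1 ?subr0 => [|i _]; last by rewrite scale0r.
    exact: subspace0.
  exists (fun i => a * b i + e i).
  have -> : \sum_i (a * b i + e i) *: vs`_i =
      a *: (\sum_i b i *: vs`_i) + \sum_i e i *: vs`_i.
    rewrite scaler_sumr -big_split; apply: eq_bigr => i _ /=.
    by rewrite scalerDl scalerA.
  by rewrite opprD addrACA -scalerBr; apply: Ws.2.
- have i_lt : (index v vs < size vs)%N by rewrite index_mem.
  exists (fun i => (i == Ordinal i_lt)%:R).
  rewrite (bigD1 (Ordinal i_lt)) //= eqxx scale1r nth_index // big1 => [|i /negPf ->].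
    by rewrite addr0 subrr; exact: subspace0.
  by rewrite scale0r.
- exists (fun=> 0); rewrite big1 ?subr0 // => i _; by rewrite scale0r.
Qed.

(** The family [b] is linearly independent modulo [W]. *)
Definition independent_mod W d (b : 'I_d -> V) :=
  forall a : 'I_d -> K, W (\sum_i a i *: b i) -> forall i, a i = 0.

Lemma independent_mod_le (vs : seq V) W d (b : 'I_d -> V) : is_subspace W ->
  (forall i, vspan ([set` vs] `|` W) (b i)) -> independent_mod W b ->
  (d <= size vs)%N.
Proof.
move=> Ws b_span b_indep.
have /boolp.choice [A bA] := fun i => vspan_seq_coord Ws (b_span i).
(* With more than size vs vectors, their coordinate matrix has a nonzero left
   kernel, whose elements are linear relations modulo W. *)
pose M := \matrix_(i, j) A i j.
rewrite leqNgt; apply/negP => lt_d.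
have kerN0 : kermx M != 0.
  rewrite -mxrank_eq0 mxrank_ker subn_eq0 -ltnNge.
  exact: leq_ltn_trans (rank_leq_col M) lt_d.
have /rowV0Pn [c /sub_kermxP cM cN0] := kerN0.
case/negP: cN0; apply/eqP/rowP => i; rewrite mxE; apply: b_indep (fun i => c 0 i) _ i.
have -> : \sum_i c 0 i *: b i = \sum_i c 0 i *: (b i - \sum_j A i j *: vs`_j).
  under [RHS]eq_bigr do rewrite scalerBr.
  rewrite sumrB [X in _ - X](_ : _ = 0) ?subr0 //.
  under eq_bigr do rewrite scaler_sumr.
  rewrite exchange_big big1 //= => j _.
  under eq_bigr do rewrite scalerA.
  rewrite -scaler_suml; have /rowP/(_ j) := cM; rewrite !mxE => cMj.
  rewrite [X in X *: _](_ : _ = 0) ?scale0r // -[RHS]cMj.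
  by apply: eq_bigr => k _; rewrite !mxE.
by apply: subspace_sum => // k; apply: subspaceZ.
Qed.

(** A quotient [U / W] spanned by the classes of finitely many vectors, which
need not lie in [U], has a dimension, at most their number: a basis is an
independent family of [U] of maximal length. *)
Lemma dim_quotient_le (vs : seq V) U W : is_subspace U -> is_subspace W ->
  W `<=` U -> U `<=` vspan ([set` vs] `|` W) ->
  exists2 d, dim_quotient U W d & (d <= size vs)%N.
Proof.
move=> Us Ws WU U_vs.
pose P d := `[< exists b : 'I_d -> V, (forall i, U (b i)) /\ independent_mod W b >].
have exP : exists d, P d by exists 0%N; apply/asboolP; exists (fun=> 0); split => [|a _] [].
have P_le d : P d -> (d <= size vs)%N.
  case/asboolP => b [Ub b_indep]; apply: (independent_mod_le Ws _ b_indep) => i.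
  exact: U_vs.
have [d Pd d_max] := ex_maxnP exP P_le; exists d; last exact: P_le.
have /asboolP [b [Ub b_indep]] := Pd.
split=> //; exists b; split=> // u Uu.
apply: contrapT => u_notin; suff /d_max : P d.+1 by rewrite ltnn.
apply/asboolP; exists (fun i => if unlift ord0 i is Some j then b j else u).
split=> [i|a]; first by case: unliftP.
rewrite big_ord_recl unlift_none; under eq_bigr do rewrite liftK.
move=> Wa; have a0 : a ord0 = 0.
  apply: contrapT => /eqP a0; case: u_notin.
  exists (fun i => - (a ord0)^-1 * a (lift ord0 i)).
  have := subspaceZ Ws (a ord0)^-1 Wa.
  rewrite scalerDr scalerA mulVf // scale1r scaler_sumr -sumrN.
  by under eq_bigr do rewrite scalerA -[_ * _]opprK -mulNr scaleNr.
move: Wa; rewrite a0 scale0r add0r => /b_indep a1 i.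
by case: (unliftP ord0 i) => [j|] ->.
Qed.
End Subspaces.

(** * Brackets and the lower central series *)

Section LieBasics.
Variables (K : fieldType) (L : lieAlgType K).
Implicit Types (x y z : L) (A B U : set L).

Lemma lieb0l y : lieb (0 : L) y = 0.
Proof. by have := liebDZl (-1) (0 : L) 0 y; rewrite scaler0 addr0 scaleN1r addNr. Qed.
Lemma lieb0r x : lieb x (0 : L) = 0.
Proof. by have := liebDZr (-1) x (0 : L) 0; rewrite scaler0 addr0 scaleN1r addNr. Qed.
Lemma liebDl x y z : lieb (x + y) z = lieb x z + lieb y z.
Proof. by have := liebDZl 1 x y z; rewrite !scale1r. Qed.
Lemma liebDr x y z : lieb x (y + z) = lieb x y + lieb x z.
Proof. by have := liebDZr 1 x y z; rewrite !scale1r. Qed.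
Lemma liebC x y : lieb x y = - lieb y x.
Proof.
apply/eqP; rewrite -addr_eq0; have := liebxx (x + y).
by rewrite liebDl !liebDr !liebxx add0r addr0 => ->.
Qed.
(** The Jacobi identity, as the derivation property of [lieb x]. *)
Lemma lieb_der x y z : lieb x (lieb y z) = lieb (lieb x y) z + lieb y (lieb x z).
Proof.
apply/eqP; rewrite -subr_eq0 opprD addrA addrAC -[- lieb y _]scaleN1r.
have /eqP := lieb_jacobi x y z.
by rewrite (liebC z x) (liebC z) -[- lieb x z]scaleN1r
  -[_ *: lieb x z]addr0 liebDZr lieb0r addr0.
Qed.

(** By bilinearity, brackets of spans are controlled by brackets of generators. *)
Lemma vspan_lieb A B U : is_subspace U -> (forall x y, A x -> B y -> U (lieb x y)) ->
  forall x y, vspan A x -> vspan B y -> U (lieb x y).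
Proof.
move=> Us ABU x y Ax; move: x Ax y.
apply: vspan_sub => [|x Ax].
  split=> [y _|a u v IHu IHv y By]; first by rewrite lieb0l; exact: subspace0.
  by rewrite liebDZl; apply: Us.2; [apply: IHu | apply: IHv].
apply: vspan_sub => [|y By]; last exact: ABU.
by split=> [|a u v Uu Uv]; rewrite ?lieb0r ?liebDZr; [exact: subspace0 | apply: Us.2].
Qed.

Lemma lie_comm_subspace A B : is_subspace (lie_comm A B).
Proof. exact: vspan_subspace. Qed.

Lemma lie_comm_gen A B x y : A x -> B y -> lie_comm A B (lieb x y).
Proof. by move=> Ax By; apply: vspan_gen; exists x => //; exists y. Qed.

Lemma lie_comm_sub A B U : is_subspace U -> (forall x y, A x -> B y -> U (lieb x y)) ->
  lie_comm A B `<=` U.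
Proof. by move=> Us ABU; apply: vspan_sub => // _ [x Ax [y By ->]]; apply: ABU. Qed.

Lemma lcs_subspace i : is_subspace (lcs L i).
Proof. by case: i => [|[|i]] //; exact: lie_comm_subspace. Qed.

Lemma lcsS i : (0 < i)%N -> lcs L i.+1 = lie_comm setT (lcs L i).
Proof. by case: i. Qed.

Lemma lcs_anti i j : (i <= j)%N -> lcs L j `<=` lcs L i.
Proof.
have lcs_step k : lcs L k.+1 `<=` lcs L k.
  elim: k => [|[|k] IH] //; rewrite lcsS //.
  by apply: lie_comm_sub => [|x y _ /IH]; [exact: lcs_subspace | exact: lie_comm_gen].
elim: j => [|j IH]; first by rewrite leqn0 => /eqP->.
by rewrite leq_eqVlt => /orP[/eqP->//|/IH ij]; apply: subset_trans (lcs_step j) ij.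
Qed.

Lemma lcs_lieb i j x y : (0 < i)%N -> (0 < j)%N ->
  lcs L i x -> lcs L j y -> lcs L (i + j) (lieb x y).
Proof.
move=> + j_gt0; elim: i j j_gt0 x y => // -[_|i IH] j j_gt0 x y _ ix jy.
  by rewrite add1n lcsS //; exact: lie_comm_gen.
move: x ix; rewrite lcsS //.
have lcs_y : is_subspace [set x | lcs L (i.+2 + j) (lieb x y)].
  split=> [|a u v Uu Uv]; rewrite /mkset ?lieb0l ?liebDZl; first exact: (lcs_subspace _).1.
  exact: (lcs_subspace _).2.
apply: (lie_comm_sub lcs_y) => x z _ iz; rewrite /mkset.
have -> : lieb (lieb x z) y = lieb x (lieb z y) - lieb z (lieb x y).
  by rewrite [lieb x (lieb z y)]lieb_der addrK.
apply: (subspaceB (lcs_subspace _)).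
  by rewrite addSn lcsS //; apply: lie_comm_gen => //; apply: IH.
by rewrite addSnnS; apply: IH => //; rewrite lcsS //; apply: lie_comm_gen.
Qed.
End LieBasics.

(** * Lyndon brackets *)

Section LyndonBrackets.
Variables (K : fieldType) (L : lieAlgType K) (d : Order.disp_t) (T : orderType d).
Variable (x : T -> L).
Implicit Types (u v w : seq T).

(** [lynb w] is the iterated bracket of the [x a] obtained by splitting [w]
recursively along its standard factorization.  The first argument of [lynb_rec]
bounds the depth of the recursion; any bound at least [size w] gives the same
value ([lynb_recE]), and the empty word is sent to [0]. *)
Fixpoint lynb_rec k w : L := if k is k'.+1 then
  match w with
  | [::] => 0
  | [:: a] => x a
  | _ => lieb (lynb_rec k' (stdl w)) (lynb_rec k' (stdr w))
  end else 0.

Definition lynb w := lynb_rec (size w) w.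

Lemma size_std w : (1 < size w)%N ->
  [/\ (0 < size (stdl w))%N, (0 < size (stdr w))%N &
      (size (stdl w) + size (stdr w) = size w)%N].
Proof.
move=> w_gt1; rewrite -!neq_nil_size stdr_neq0 // stdl_neq0; last first.
  by rewrite neq_nil_size; exact: ltnW.
by rewrite -size_cat std_cat.
Qed.

Lemma lynb_recE k w : (size w <= k)%N -> lynb_rec k w = lynb w.
Proof.
move En: (size w) => n; elim/ltn_ind: n k w En => n IH [|k] w wn; rewrite /lynb wn.
  by rewrite leqn0 => /eqP ->.
case: n IH wn => [|n] IH wn nk; first by case: w wn.
case: w wn => [|a [|b w]] // wn.
have [] := @size_std (a :: b :: w) isT; rewrite wn /=.
move: (stdl _) (stdr _) => s t s_gt0 t_gt0 st.
by congr lieb; rewrite (IH _ _ _ _ erefl) ?(IH _ _ n _ erefl) //; lia.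
Qed.

Lemma lynb1 a : lynb [:: a] = x a. Proof. by []. Qed.

Lemma lynb_std w : (1 < size w)%N -> lynb w = lieb (lynb (stdl w)) (lynb (stdr w)).
Proof.
case: w => [|a [|b w]] // w_gt1; have [s_gt0 t_gt0 /= st] := size_std w_gt1.
rewrite -(@lynb_recE (size w).+1 (stdl _)) -?(@lynb_recE (size w).+1 (stdr _)) //; lia.
Qed.

Lemma lynb_cat u v : lyndon u -> lyndon v -> (size u <= 1)%N || (v <= stdr u)%O ->
  lynb (u ++ v) = lieb (lynb u) (lynb v).
Proof.
move=> lu lv uv; rewrite lynb_std ?stdl_cat ?stdr_cat //.
have := lyndon_neq0 lu; have := lyndon_neq0 lv.
by rewrite !neq_nil_size size_cat; lia.
Qed.

(** The span of the brackets of the Lyndon words that satisfy [P]. *)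
Definition lynspan (P : pred (seq T)) : set L :=
  vspan [set z | exists2 w, lyndon w && P w & z = lynb w].

Lemma lynspan_subspace P : is_subspace (lynspan P).
Proof. exact: vspan_subspace. Qed.

Lemma lynspan_gen (P : pred (seq T)) w : lyndon w -> P w -> lynspan P (lynb w).
Proof. by move=> lw Pw; apply: vspan_gen; exists w => //; rewrite lw. Qed.

Lemma lynspanS (P Q : pred (seq T)) : (forall w, lyndon w -> P w -> Q w) ->
  lynspan P `<=` lynspan Q.
Proof.
move=> PQ; apply: vspan_sub => [|_ [w /andP[lw Pw] ->]]; first exact: lynspan_subspace.
by apply: lynspan_gen => //; apply: PQ.
Qed.

Lemma lynb_lcs w : w != [::] -> lcs L (size w) (lynb w).
Proof.
move En: (size w) => n; elim/ltn_ind: n w En => n IH w wn wN0.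
have [w_gt1|] := ltnP 1 (size w).
  have [s_gt0 t_gt0 st] := size_std w_gt1.
  rewrite (lynb_std w_gt1) -wn -st; apply: lcs_lieb => //; apply: IH; rewrite ?neq_nil_size //; lia.
by rewrite -wn; case: w wN0 {wn} => [|a [|b w]].
Qed.
End LyndonBrackets.

Section LyndonSpan.
Variables (K : fieldType) (L : lieAlgType K) (d : Order.disp_t) (T : finOrderType d).
Variable (x : T -> L).
Implicit Types (u v w : seq T).

(** Over a finite alphabet, the lexicographic order is well founded on words of
bounded length. *)
Lemma lexi_bounded_ind m (P : seq T -> Prop) :
  (forall v, (size v <= m)%N ->
     (forall w, (size w <= m)%N -> (w < v)%O -> P w) -> P v) ->
  forall v, (size v <= m)%N -> P v.
Proof.
move=> IH v; pose rank v := #|[pred w : m.-bseq T | (val w < v)%O]|.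
move En: (rank v) => n; elim/ltn_ind: n v En => n IHn v vn vm.
apply: IH => // w wm wv; apply: (IHn (rank w)) => //; rewrite -vn.
apply/proper_card/fintype.properP; split.
  by apply/fintype.subsetP => s; rewrite !inE => /lt_trans; apply.
by exists (Bseq wm); rewrite !inE //= ltxx.
Qed.

(** The bracket of two Lyndon brackets is a combination of Lyndon brackets of the
same weight.  The extra condition [w < v] is what makes the induction work: if
[u = u1 u2] with [u2 < v], the Jacobi identity produces brackets
[[u1, [u2, v]]] and [[u2, [u1, v]]], where the inner bracket is a combination
of words below [v] by induction on the total length, so that each outer bracket
involves only words below [v]. *)
Lemma lieb_lynb u v : lyndon u -> lyndon v -> (u < v)%O ->
  lynspan x (fun w => (size w == size u + size v)%N && (w < v)%O) (lieb (lynb x u) (lynb x v)).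
Proof.
move Em: (size u + size v)%N => m; elim/ltn_ind: m u v Em => m IHm u v.
move=> Em; have vm : (size v <= m)%N by rewrite -Em leq_addl.
move: v vm u Em; apply: lexi_bounded_ind => v vm IHv u Em lu lv lt_uv.
have luv := lyndon_cat lu lv lt_uv.
have uN0 := lyndon_neq0 lu; have vN0 := lyndon_neq0 lv.
have [u_std|] := boolP ((size u <= 1)%N || (v <= stdr u)%O).
  rewrite -lynb_cat //; apply: lynspan_gen => //; rewrite size_cat Em eqxx /=.
  by move/lyndonP: luv => [_ /(_ u v)]; apply.
rewrite negb_or -ltnNge -ltNge => /andP[u_gt1 lt_u2v].
have [u1_gt0 u2_gt0 szu] := size_std u_gt1.
have lu1 := lyndon_stdl u_gt1 lu; have lu2 := lyndon_stdr u_gt1.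
have lt_u12 := stdl_lt_stdr u_gt1 lu.
have lt_u1v := lt_trans lt_u12 lt_u2v.
rewrite (lynb_std x u_gt1).
move: (stdl u) (stdr u) u1_gt0 u2_gt0 szu lu1 lu2 lt_u12 lt_u1v lt_u2v.
move=> u1 u2 u1_gt0 u2_gt0 szu lu1 lu2 lt_u12 lt_u1v lt_u2v {u_gt1}.
pose S := lynspan x (fun w => (size w == m)%N && (w < v)%O).
have Ss : is_subspace S by exact: lynspan_subspace.
have vN0' : (0 < size v)%N by rewrite -neq_nil_size.
(* The induction hypothesis on v, whichever of s and t is the larger. *)
have bracket s t : lyndon s -> lyndon t -> (s < v)%O -> (t < v)%O ->
    (0 < size s)%N -> (0 < size t)%N ->
    (size s + size t = m)%N -> S (lieb (lynb x s) (lynb x t)).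
  move=> ls lt_ sv tv s_gt0 t_gt0 st.
  case: (ltgtP s t) => [lt_st|lt_ts|->]; last by rewrite liebxx; exact: subspace0.
  - have tm : (size t <= m)%N by rewrite -st leq_addl.
    have := IHv t tm tv s st ls lt_ lt_st.
    by apply: lynspanS => w _ /andP[-> /= wt]; apply: lt_trans wt tv.
  - rewrite liebC; apply: (subspaceN Ss).
    have sm : (size s <= m)%N by rewrite -st leq_addr.
    have ts : (size t + size s)%N = m by rewrite addnC.
    have := IHv s sm sv t ts lt_ ls lt_ts.
    by apply: lynspanS => w _ /andP[-> /= wt]; apply: lt_trans wt sv.
have -> : lieb (lieb (lynb x u1) (lynb x u2)) (lynb x v) =
  lieb (lynb x u1) (lieb (lynb x u2) (lynb x v)) - lieb (lynb x u2) (lieb (lynb x u1) (lynb x v)).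
  by rewrite [lieb (lynb x u1) (lieb _ _)]lieb_der addrK.
apply: (subspaceB Ss).
  have u2v_m : (size u2 + size v < m)%N.
    by rewrite -Em -szu -addnA -[X in (X < _)%N]add0n ltn_add2r.
  have := IHm _ u2v_m u2 v erefl lu2 lv lt_u2v.
  apply: (@vspan_lieb _ _ [set lynb x u1]) => //; last exact: vspan_gen.
  move=> _ _ -> [w /and3P[lw /eqP wsz wv] ->].
  by apply: bracket; rewrite ?wsz ?addn_gt0 ?vN0' ?orbT // addnA szu.
have u1v_m : (size u1 + size v < m)%N.
  by rewrite -Em -szu addnAC -[X in (X < _)%N]addn0 ltn_add2l.
have := IHm _ u1v_m u1 v erefl lu1 lv lt_u1v.
apply: (@vspan_lieb _ _ [set lynb x u2]) => //; last exact: vspan_gen.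
move=> _ _ -> [w /and3P[lw /eqP wsz wv] ->].
by apply: bracket; rewrite ?wsz ?addn_gt0 ?vN0' ?orbT // addnCA addnA szu.
Qed.

Lemma lieb_lynspan y z : lynspan x predT y -> lynspan x predT z ->
  lynspan x (fun w => 1 < size w)%N (lieb y z).
Proof.
have Ss := lynspan_subspace x (fun w => 1 < size w)%N; apply: vspan_lieb => //.
move=> _ _ [u /andP[lu _] ->] [v /andP[lv _] ->].
have := lyndon_neq0 lu; have := lyndon_neq0 lv; rewrite !neq_nil_size => v0 u0.
case: (ltgtP u v) => [uv|vu|->].
- apply: lynspanS (lieb_lynb lu lv uv) => w _ /andP[/eqP-> _]; exact: (leq_add u0 v0).
- rewrite liebC; apply: (subspaceN Ss).
  apply: lynspanS (lieb_lynb lv lu vu) => w _ /andP[/eqP-> _]; exact: (leq_add v0 u0).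
- by rewrite liebxx; exact: Ss.1.
Qed.

End LyndonSpan.

(** * Central extensions of nilpotent Lie algebras *)

Section Presentation.
Variables (K : fieldType) (F L : lieAlgType K) (p : F -> L).
Hypotheses (p_hom : is_lie_hom p) (p_surj : range p = setT).
Let R := p @^-1` [set 0].

Lemma lie_hom0 : p 0 = 0.
Proof. by have := p_hom.1 (-1) 0 0; rewrite scaler0 addr0 scaleN1r addNr. Qed.

Lemma lie_homB u v : p (u - v) = p u - p v.
Proof. by rewrite addrC -scaleN1r p_hom.1 scaleN1r addrC. Qed.

Lemma lie_hom_lcs i u : lcs F i u -> lcs L i (p u).
Proof.
elim: i u => [|[|i] IH] u //; rewrite (@lcsS _ F i.+1) // (@lcsS _ L i.+1) // => iu.
have Us : is_subspace [set w | lie_comm setT (lcs L i.+1) (p w)].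
  split=> [|a v w Uv Uw]; rewrite /mkset ?lie_hom0 ?p_hom.1.
    exact: (lie_comm_subspace _ _).1.
  exact: (lie_comm_subspace _ _).2.
apply: (lie_comm_sub Us _ iu) => v w _ /IH pw; rewrite /mkset p_hom.2.
exact: lie_comm_gen.
Qed.

(** [F] is the sum of [R] and of the span of the Lyndon brackets in lifts of
generators of [L]: the image of this span is a subalgebra of [L]. *)
Lemma lynspan_lift n (y : 'I_n -> L) (x : 'I_n -> F) :
  smallest (@is_subalgebra K L) (range y) = setT -> (forall i, p (x i) = y i) ->
  forall f, exists2 a, lynspan x predT a & R (f - a).
Proof.
move=> y_gen xy f.
suff [a Sa pa] : (p @` lynspan x predT) (p f).
  by exists a => //; rewrite /R /preimage /= lie_homB pa subrr.
have : [set: L] (p f) by []; rewrite -y_gen; apply; split; last first.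
  move=> _ [i _ <-]; exists (x i) => //; rewrite -(lynb1 x); exact: lynspan_gen.
have Ss := lynspan_subspace x predT.
split=> [|_ _ [u Su <-] [v Sv <-]].
  split=> [|a _ _ [u Su <-] [v Sv <-]]; first by exists 0; [exact: Ss.1 | exact: lie_hom0].
  by exists (a *: u + v); [exact: Ss.2 | rewrite p_hom.1].
exists (lieb u v); last by rewrite p_hom.2.
exact: lynspanS (lieb_lynspan Su Sv).
Qed.

(** The Lyndon brackets of weight [2], ..., [c + 1] in the [x i]. *)
Definition lyn_family n (x : 'I_n -> F) c : seq F :=
  [seq lynb x (val w) | q <- iota 2 c, w <- enum [pred w : q.-tuple 'I_n | lyndon w]].

Lemma size_lyn_family n (x : 'I_n -> F) c :
  ((size (lyn_family x c))%:R : rat) <= \sum_(1 <= j < c.+1) witt n j.+1.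
Proof.
have -> : size (lyn_family x c) =
    (\sum_(1 <= j < c.+1) #|[pred w : j.+1.-tuple 'I_n | lyndon w]|)%N.
  rewrite size_allpairs_dep sumnE big_map big_add1 /= -[2%N]addn1 iotaDl big_map.
  rewrite /index_iota subn0; have -> : iota 1 c = [seq j.+1 | j <- iota 0 c].
    by rewrite -(iotaDl 1).
  by rewrite big_map; apply: eq_bigr => j _; rewrite -cardE.
rewrite natr_sum; apply: ler_sum => j _.
apply: le_trans (card_lyndon_le_witt n (ltn0Sn j)); rewrite ler_nat.
by apply: subset_leq_card; apply/fintype.subsetP => w; rewrite !inE.
Qed.

(** [F^2] is spanned modulo [[F, R]] by the Lyndon brackets of weight between [2]
and [c + 1]. *)
Lemma lcs2_span n (y : 'I_n -> L) (x : 'I_n -> F) c :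
  smallest (@is_subalgebra K L) (range y) = setT -> (forall i, p (x i) = y i) ->
  lcs L c.+1 = [set 0] ->
  lcs F 2 `<=` vspan ([set` lyn_family x c] `|` lie_comm setT R).
Proof.
move=> y_gen xy L_nil; set W := lie_comm setT R; set U := vspan _.
have Us : is_subspace U by exact: vspan_subspace.
have WU : W `<=` U by move=> w Ww; apply: vspan_gen; right.
have WC u v : R u -> U (lieb u v).
  by move=> Ru; rewrite liebC; apply: (subspaceN Us); apply: WU; apply: lie_comm_gen.
have F_nil i : (c.+1 < i)%N -> lcs F i `<=` W.
  move=> ci; apply: (subset_trans (lcs_anti ci)); rewrite lcsS //.
  apply: lie_comm_sub => [|u v _ /lie_hom_lcs]; first exact: lie_comm_subspace.
  by rewrite L_nil => Rv; apply: lie_comm_gen.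
have lynU : lynspan x (fun w => 1 < size w)%N `<=` U.
  apply: vspan_sub => // _ [w /andP[lw w_gt1] ->].
  have [w_le|w_gt] := leqP (size w) c.+1; last first.
    by apply: WU; apply: (F_nil _ w_gt); apply: lynb_lcs; exact: lyndon_neq0.
  apply: vspan_gen; left => /=; apply/allpairsPdep.
  exists (size w), (in_tuple w); split=> //; last by rewrite mem_enum.
  by rewrite mem_iota; lia.
rewrite lcsS //; apply: lie_comm_sub => // f g _ _.
have [a Sa Ra] := lynspan_lift y_gen xy f; have [b Sb Rb] := lynspan_lift y_gen xy g.
have -> : lieb f g = lieb a b + (lieb (f - a) g + lieb a (g - b)).
  by rewrite addrCA -liebDr [b + _]addrC subrK -liebDl subrK.
apply: (subspaceD Us); first by apply: lynU; apply: lieb_lynspan.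
by apply: (subspaceD Us); [exact: WC | apply: WU; apply: lie_comm_gen].
Qed.

End Presentation.

Unset Implicit Arguments.

Theorem theorem4p1 (K : fieldType) (L : lieAlgType K) (c n : nat)
    (hc : nilpotent_of_class L c) (hn : generated_by L n)
    (F : lieAlgType K) (R : set F) (hFR : is_free_presentation R L) :
  exists d : nat, dim_schur_multiplier R d /\
    (d%:R : rat) <= \sum_(1 <= j < c.+1) witt n j.+1.
Proof.
have [L_nil _] := hc; have [y y_gen] := hn.
have [_ [R_sub R_ideal] [p [p_hom p_surj RE]]] := hFR.
have /boolp.choice [x xy] : forall i, exists f, p f = y i.
  move=> i; have : [set: L] (y i) by []; rewrite -p_surj => -[f _ <-].
  by exists f.
have W_sub : lie_comm setT R `<=` lcs F 2 `&` R.
  apply: lie_comm_sub => [|u v _ Rv]; first exact: subspaceI (lcs_subspace F 2) R_sub.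
  by split; [exact: lie_comm_gen | exact: R_ideal].
have M_span := lcs2_span p_hom y_gen xy L_nil; rewrite -RE in M_span.
have [d dimM d_le] := dim_quotient_le (subspaceI (lcs_subspace F 2) R_sub)
  (lie_comm_subspace _ _) W_sub (subset_trans (@subIsetl _ _ _) M_span).
exists d; split=> //; apply: le_trans (size_lyn_family x c).
by rewrite ler_nat.
Qed.
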